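(* The following condition on the weakness sequences $\tau=\{t_k\}_{k=1}^\infty$ $$\forall\,\{a_j\}\in\ell_2,\ a_j\ge0,\ j=1,2,\dots,\qquad \liminf_{n\to\infty}\frac{a_n}{t_n}\sum_{j=1}^n a_j=0$$ is the necessary and sufficient condition for the $A_1(\mathcal{D})$-convergence of the Weak Greedy Algorithm WGA($\tau$) for all dictionaries $\mathcal{D}$.
   Context: $H$ is a real Hilbert space with inner product $\langle\cdot,\cdot\rangle$ and norm $\|x\|=\langle x,x\rangle^{1/2}$. A dictionary is a set $\mathcal{D}\subset H$ such that $\|g\|=1$ for every $g\in\mathcal{D}$ and the closure of the linear span of $\mathcal{D}$ is $H$. $A_1(\mathcal{D})$ is the closure in $H$ of the convex hull of $\{\pm g: g\in\mathcal{D}\}$. A weakness sequence is a sequence $\tau=\{t_k\}_{k=1}^\infty$ of numbers $t_k\in[0,1]$. Weak Greedy Algorithm WGA($\mathcal{D},\tau$) (also written WGA($\tau$)): given $f\in H$, put $f_0=f$. For each $m\ge1$, inductively: (i) $\varphi_m\in\mathcal{D}$ is any element satisfying $|\langle f_{m-1},\varphi_m\rangle|\ge t_m\sup_{g\in\mathcal{D}}|\langle f_{m-1},g\rangle|$ (if $t_m=1$ it is assumed that such a maximizer exists); (ii) $f_m=f_{m-1}-\langle f_{m-1},\varphi_m\rangle\varphi_m$. A realization is any outcome of admissible choices of the $\varphi_m$. The algorithm $A_1(\mathcal{D})$-converges if, for the given dictionary $\mathcal{D}$ and each $f\in A_1(\mathcal{D})$, every realization of the algorithm satisfies $\lim_{m\to\infty}\|f_m\|=0$.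 *)

(* Defs.v *)
From mathcomp Require Import all_boot all_order all_algebra.
From mathcomp Require Import all_classical all_reals all_analysis.

Set Implicit Arguments.
Unset Strict Implicit.
Unset Printing Implicit Defensive.

Import Order.TTheory GRing.Theory Num.Theory numFieldNormedType.Exports.

Local Open Scope classical_set_scope.
Local Open Scope ring_scope.

(* A real Hilbert space is a [completeNormedModType R] [H] together with a
   symmetric positive definite form inducing its norm. *)
Definition induces_norm (R : realType) (H : completeNormedModType R)
    (ip : {dot H for idfun}) : Prop :=
  forall x : H, `|x| = Num.sqrt (ip x x).

Definition linear_span (R : realType) (H : lmodType R) (D : set H) : set H :=
  [set x | exists (n : nat) (c : 'I_n -> R) (g : 'I_n -> H),
     (forall i, D (g i)) /\ x = \sum_(i < n) c i *: g i].

Definition convex_hull (R : realType) (H : lmodType R) (A : set H) : set H :=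
  smallest (@convex_set R H) A.

Definition dictionary (R : realType) (H : normedModType R) (D : set H) : Prop :=
  (forall g, D g -> `|g| = 1) /\ closure (linear_span D) = setT.

Definition A1 (R : realType) (H : normedModType R) (D : set H) : set H :=
  closure (convex_hull [set x | D x \/ D (- x)]).

(* Sequences indexed by 1, 2, ... are shifted to start at 0: [t k] and [phi k]
   stand for $t_{k+1}$ and $\varphi_{k+1}$, whereas [f m] is $f_m$. *)
Definition weakness_sequence (R : realType) (t : nat -> R) : Prop :=
  forall k, 0 <= t k <= 1.

(* When [D] has no element attaining the supremum required by a step with
   [t m = 1], no realization exists along that branch. The supremum is that of
   a set bounded by `|f m| and, since [phi m] lies in [D], nonempty. *)
Definition WGA_realization (R : realType) (H : normedModType R)
    (ip : {dot H for idfun}) (D : set H) (t : nat -> R) (x : H)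
    (f phi : nat -> H) : Prop :=
  f 0%N = x /\
  forall m : nat,
    [/\ D (phi m),
        t m * sup [set `|ip (f m) g| | g in D] <= `|ip (f m) (phi m)|
      & f m.+1 = f m - ip (f m) (phi m) *: phi m].

Definition A1_converges (R : realType) (H : normedModType R)
    (ip : {dot H for idfun}) (D : set H) (t : nat -> R) : Prop :=
  forall x : H, A1 D x ->
  forall f phi : nat -> H, WGA_realization ip D t x f phi ->
  (fun m => `|f m|) @ \oo --> (0 : R).

(* The quotient is taken in the extended reals because [t n] may vanish: there
   a / 0 = +oo for a > 0, and 0 / 0 = 0. The value given to 0 / 0 does not
   affect the condition, which ranges over all sequences [a]: a null [a n] can
   be replaced by a positive square-summable one wherever [t n = 0]. *)
Definition liminf_condition (R : realType) (t : nat -> R) : Prop :=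
  forall a : nat -> R,
    (forall j, 0 <= a j) ->
    cvgn (series (fun j => a j ^+ 2)) ->
    limn_einf (fun n => (a n)%:E / (t n)%:E * (\sum_(j < n.+1) a j)%:E)%E = 0%E.

(* Main.v *)
(* Sufficiency. For f in A_1(D), pairing f_m = f - sum_{j<m} c_j phi_j with f_m
   gives |f_m|^2 <= s_m (1 + sum_{j<m} |c_j|), where s_m = sup_g |<f_m, g>|
   satisfies t_m s_m <= |c_m|. As (c_j) is in l^2, the condition makes the right
   side, hence the nonincreasing |f_m|, arbitrarily small.

   Necessity. Suppose c t_n <= a_n sum_{j<=n} a_j for large n, (a_j) in l^2. In
   l^2(nat), take for D the unit vectors alpha e_i - beta e_j with
   alpha, beta >= 0. On a vector x with nonnegative entries and greatest entry
   M, the elements of D have inner products at most M in absolute value, so a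
   step of coefficient b is admissible at time n as soon as b >= t_n M. At step n
   we use b = a_n when a_n <= M/4, moving a bit of the greatest entry into a
   small one; otherwise we delete the greatest entry (b = M). All entries but one
   stay null or comparable to M, so the sum of the entries is comparable to
   |x|^2 / M. This sum grows at the rate of the a_n, which yields
   M sum_{j<n} a_j <= 25 |x_0|^2 and makes all steps admissible. Only sum b_n^2,
   a small amount, is lost on |x_0|^2, so the residuals do not tend to 0. Scaling
   puts x_0 into A_1(D). *)

From HB Require Import structures.
Require Import Defs.
From mathcomp Require Import all_boot all_order all_algebra.
From mathcomp Require Import all_classical all_reals all_analysis.
From mathcomp Require Import ring lra.

Set Implicit Arguments.
Unset Strict Implicit.
Unset Printing Implicit Defensive.

Import Order.TTheory GRing.Theory Num.Theory numFieldNormedType.Exports.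

Local Open Scope classical_set_scope.
Local Open Scope ring_scope.

(** * The Hilbert space of square-summable sequences *)

Section DotProduct.
Variables (R : realType) (U : lmodType R) (ip : {dot U for idfun}).

Lemma dotC x y : ip x y = ip y x.
Proof. by rewrite [LHS]hermitian_subproof expr0 mul1r. Qed.

Lemma dot0r x : ip x 0 = 0. Proof. exact: raddf0. Qed.
Lemma dotDr x y z : ip x (y + z) = ip x y + ip x z. Proof. exact: raddfD. Qed.
Lemma dotBr x y z : ip x (y - z) = ip x y - ip x z. Proof. exact: raddfB. Qed.
Lemma dotZr a x y : ip x (a *: y) = a * ip x y. Proof. exact: linearZ_LR. Qed.
Lemma dotBl x y z : ip (x - y) z = ip x z - ip y z.
Proof. by rewrite !(dotC _ z) dotBr. Qed.
Lemma dotZl a x y : ip (a *: x) y = a * ip x y.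
Proof. by rewrite !(dotC _ y) dotZr. Qed.

Lemma dot_ge0 x : 0 <= ip x x.
Proof.
by have [->|/neq0_dnorm_gt0/ltW//] := eqVneq x 0; rewrite dot0r.
Qed.

Lemma dot_cauchy_schwarz x y : ip x y ^+ 2 <= ip x x * ip y y.
Proof.
have [->|/(neq0_dnorm_gt0 (s := ip)) y0] := eqVneq y 0.
  by rewrite !dot0r expr0n mulr0.
(* This vector is [ip y y] times the component of [x] orthogonal to [y]; its square is [ip y y]
   times the Cauchy-Schwarz defect. *)
have := dot_ge0 (ip y y *: x - ip x y *: y).
rewrite !(dotBl, dotBr, dotZl, dotZr) (dotC y x).
rewrite (_ : _ - _ = ip y y * (ip x x * ip y y - ip x y ^+ 2)); last by ring.
by rewrite pmulr_rge0// subr_ge0.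
Qed.

Lemma ler_sqrt_dotD x y :
  Num.sqrt (ip (x + y) (x + y)) <= Num.sqrt (ip x x) + Num.sqrt (ip y y).
Proof.
have sx := sqr_sqrtr (dot_ge0 x); have sy := sqr_sqrtr (dot_ge0 y).
have x0 := sqrtr_ge0 (ip x x); have y0 := sqrtr_ge0 (ip y y).
rewrite -(@ler_pXn2r _ 2)// ?nnegrE ?sqrtr_ge0 ?addr_ge0// sqr_sqrtr ?dot_ge0//.
rewrite sqrrD sx sy dotDr !(dotC (x + y)) !dotDr (dotC y x).
have : ip x y <= Num.sqrt (ip x x) * Num.sqrt (ip y y).
  rewrite -sqrtrM ?dot_ge0// (le_trans (ler_norm _))// -sqrtr_sqr ler_wsqrtr//.
  exact: dot_cauchy_schwarz.
by rewrite mulr2n; lra.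
Qed.

End DotProduct.

(** * Square-summable sequences as a complete inner product space *)

Section SquareSummable.
Variable R : realType.
Implicit Types x y : nat -> R.

Lemma nneg_series_le (u : nat -> R) (C : R) : (forall i, 0 <= u i) ->
  (forall n, \sum_(i < n) u i <= C) -> cvgn (series u) /\ limn (series u) <= C.
Proof.
move=> u0 uC.
have sC n : series u n <= C by rewrite seriesEord; exact: uC.
have cu : cvgn (series u).
  apply: nondecreasing_is_cvgn; first exact: nondecreasing_series.
  by exists C => _ [n _ <-].
by split=> //; apply: limr_le => //; exact: nearW.
Qed.

Lemma nneg_sum_le_lim (u : nat -> R) n : (forall i, 0 <= u i) ->
  cvgn (series u) -> \sum_(i < n) u i <= limn (series u).
Proof.
move=> u0 cu; have nd : nondecreasing_seq (series u).
  exact: nondecreasing_series.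
by have := nondecreasing_cvgn_le nd cu n; rewrite seriesEord.
Qed.

Definition sqsum : {pred nat -> R} :=
  fun x => `[< cvgn (series (fun i => x i ^+ 2)) >].

Lemma sqsumP x : reflect (exists C, forall n, \sum_(i < n) x i ^+ 2 <= C)
  (x \in sqsum).
Proof.
apply: (iffP (asboolP _)) => [cx|[C xC]].
  by exists (limn (series (fun i => x i ^+ 2))) => n;
    apply: nneg_sum_le_lim => // i; exact: sqr_ge0.
by case: (@nneg_series_le (fun i => x i ^+ 2) C) => // i; exact: sqr_ge0.
Qed.

Lemma sqsum_submod_closed : submod_closed sqsum.
Proof.
split=> [|a x y /sqsumP[C xC] /sqsumP[C' yC']]; apply/sqsumP.
  by exists 0 => n; rewrite big1// => i _; rewrite expr0n.
(* From (u + v)^2 + (u - v)^2 = 2 u^2 + 2 v^2 with u = a x_i and v = y_i. *)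
exists (2 * a ^+ 2 * C + 2 * C') => n.
apply: (@le_trans _ _ (\sum_(i < n) (2 * a ^+ 2 * x i ^+ 2 + 2 * y i ^+ 2))).
  apply: ler_sum => i _; rewrite -subr_ge0.
  rewrite (_ : _ - _ = (a * x i - y i) ^+ 2) ?sqr_ge0//.
  by rewrite [(a *: x + y) i](_ : _ = a * x i + y i)//; ring.
rewrite big_split/= -!mulr_sumr.
apply: lerD; apply: ler_wpM2l => //.
- by apply: mulr_ge0 => //; exact: sqr_ge0.
- exact: xC.
- exact: yC'.
Qed.

HB.instance Definition _ :=
  GRing.isSubmodClosed.Build R (nat -> R) sqsum sqsum_submod_closed.

Record l2 := L2 { l2val :> nat -> R; _ : l2val \in sqsum }.

HB.instance Definition _ := [isSub for l2val].
HB.instance Definition _ := [Choice of l2 by <:].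
HB.instance Definition _ := [SubChoice_isSubZmodule of l2 by <:].
HB.instance Definition _ := [SubZmodule_isSubLmodule of l2 by <:].

Implicit Types f g : l2.

Lemma l2P f g : (forall i, f i = g i) -> f = g.
Proof. by move=> fg; apply/val_inj/funext. Qed.

Definition l2dot f g := limn (series (fun i => f i * g i)).

Lemma l2_cvg_dot f g : cvgn (series (fun i => f i * g i)).
Proof.
apply: normed_cvg => /=.
case/sqsumP: (valP f) => C fC; case/sqsumP: (valP g) => D gD.
have [] // := @nneg_series_le (fun i => `|f i * g i|) (C + D) => // n.
rewrite (le_trans _ (lerD (fC n) (gD n)))// -big_split ler_sum//= => i _.
by rewrite ler_norml; apply/andP; split; nra.
Qed.

Lemma l2dotC f g : l2dot f g = l2dot g f.
Proof. by rewrite /l2dot; under eq_fun do rewrite mulrC. Qed.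

Lemma l2dot_linear f : scalar (l2dot f).
Proof.
move=> a x y; apply/cvg_lim => //.
rewrite (_ : series _ = (fun n => a * series (fun i => f i * x i) n +
                                  series (fun i => f i * y i) n)).
  by apply: cvgD; [apply: cvgM; [exact: cvg_cst|]|]; exact: l2_cvg_dot.
apply/funext => n; rewrite /series/= mulr_sumr -big_split/=.
apply: eq_bigr => i _.
by transitivity (f i * (a * x i + y i)); [|rewrite mulrDr mulrCA].
Qed.

Lemma l2dot_sum_le f n : \sum_(i < n) f i ^+ 2 <= l2dot f f.
Proof.
have := @nneg_sum_le_lim (fun i => f i ^+ 2) n (fun i => sqr_ge0 _).
by apply; exact: l2_cvg_dot.
Qed.

Lemma l2dot_le f C : (forall n, \sum_(i < n) f i ^+ 2 <= C) -> l2dot f f <= C.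
Proof.
by move=> fC; have [] := @nneg_series_le (fun i => f i ^+ 2) C (fun i => sqr_ge0 _).
Qed.

Lemma l2dot_coord_le f i : f i ^+ 2 <= l2dot f f.
Proof.
apply: le_trans (l2dot_sum_le f i.+1); rewrite big_ord_recr/= lerDr.
by apply: sumr_ge0 => j _; exact: sqr_ge0.
Qed.

Lemma l2dot_gt0 f : f != 0 -> 0 < l2dot f f.
Proof.
apply: contra_neqT; rewrite -leNgt => f0; apply: l2P => i.
apply/eqP; rewrite -sqrf_eq0 eq_le sqr_ge0 andbT.
exact: le_trans (l2dot_coord_le f i) f0.
Qed.

Lemma l2dot_bilinear : bilinear_for *%R *%R l2dot.
Proof.
split=> g; last exact: l2dot_linear.
by move=> a x y; rewrite /= !(l2dotC _ g) l2dot_linear.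
Qed.

HB.instance Definition _ :=
  bilinear_isBilinear.Build R l2 l2 R *%R *%R l2dot l2dot_bilinear.

Lemma l2dot_hermitian f g : l2dot f g = (-1) ^+ false * idfun (l2dot g f).
Proof. by rewrite expr0 mul1r l2dotC. Qed.

HB.instance Definition _ :=
  isHermitianSesquilinear.Build R l2 false idfun l2dot l2dot_hermitian.
HB.instance Definition _ := isDotProduct.Build R l2 l2dot l2dot_gt0.

Definition l2ip : {dot l2 for idfun} := l2dot.

Definition l2norm f := Num.sqrt (l2ip f f).

Lemma l2normD f g : l2norm (f + g) <= l2norm f + l2norm g.
Proof. exact: ler_sqrt_dotD. Qed.

Lemma l2normZ a f : l2norm (a *: f) = `|a| * l2norm f.
Proof.
by rewrite /l2norm dotZl dotZr mulrA -expr2 sqrtrM ?sqr_ge0// sqrtr_sqr.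
Qed.

Lemma l2norm0_eq0 f : l2norm f = 0 -> f = 0.
Proof.
move=> /eqP; rewrite sqrtr_eq0 => f0; apply/eqP; apply: contraTT f0.
by rewrite -ltNge => /l2dot_gt0.
Qed.

HB.instance Definition _ :=
  Lmodule_isNormed.Build R l2 l2normD l2normZ l2norm0_eq0.

Lemma l2norm_sqr f : `|f| ^+ 2 = l2dot f f.
Proof. by rewrite sqr_sqrtr// (dot_ge0 l2ip). Qed.

Lemma l2_coord_le f i : `|f i| <= `|f|.
Proof.
rewrite -(@ler_pXn2r _ 2)// ?nnegrE// l2norm_sqr real_normK ?num_real//.
exact: l2dot_coord_le.
Qed.

(** Coordinates are 1-Lipschitz, so they converge along [F]. The coordinatewise limit [z] is within
    e of every point of an e-small set of [F], which gives both its square-summability and the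
    convergence in norm. *)
Lemma l2_complete (F : set_system l2) : ProperFilter F -> cauchy F -> cvg F.
Proof.
move=> FF Fc.
have Fc' e : 0 < e -> exists2 A, F A & forall x y : l2, A x -> A y -> `|x - y| < e.
  move=> e0; have /cauchy_ballP/(_ e e0) := Fc.
  move=> [[A B]]/= [FA FB] AB.
  exists (A `&` B); first exact: filterI.
  move=> x y [Ax _] [_ By]; have := AB (x, y) (conj Ax By).
  by rewrite -ball_normE.
have cc i : cvg ((fun x : l2 => x i) @ F).
  apply/cauchy_cvgP/cauchy_ballP => e e0.
  have [A FA Ae] := Fc' _ e0.
  exists ((fun x : l2 => x i) @` A, (fun x : l2 => x i) @` A) => /=.
    by split; apply: (@filterS _ F _ A) => // f Af; exists f.
  move=> [_ _] [[x Ax <-]] [y Ay <-] /=; rewrite -ball_normE/=.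
  by apply: le_lt_trans (Ae _ _ Ax Ay); exact: (l2_coord_le (x - y)).
pose z i : R := lim ((fun x : l2 => x i) @ F).
(* Only finitely many coordinates are involved, so the bound for x in [A] passes to the limit along
   [F]. *)
have key e A (y : l2) n : 0 < e -> F A ->
    (forall x y : l2, A x -> A y -> `|x - y| < e) -> A y ->
    \sum_(i < n) (y i - z i) ^+ 2 <= e ^+ 2.
  move=> e0 FA Ae Ay.
  have cs : (fun x : l2 => \sum_(i < n) (y i - x i) ^+ 2) @ F -->
      (\sum_(i < n) (y i - z i) ^+ 2).
    elim: n => [|n IH].
      by rewrite big_ord0; under eq_fun do rewrite big_ord0; exact: cvg_cst.
    rewrite big_ord_recr/= expr2; under eq_fun do rewrite big_ord_recr/= expr2.
    by apply: cvgD => //; apply: cvgM; apply: cvgB; [exact: cvg_cst|exact: cc|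
      exact: cvg_cst|exact: cc].
  have -> : \sum_(i < n) (y i - z i) ^+ 2 =
      lim ((fun x : l2 => \sum_(i < n) (y i - x i) ^+ 2) @ F).
    by apply/esym/cvg_lim.
  apply: limr_le; first by apply/cvg_ex; exists (\sum_(i < n) (y i - z i) ^+ 2).
  apply: filterS FA => x Ax.
  apply: le_trans (l2dot_sum_le (y - x) n) _.
  by rewrite -l2norm_sqr lerXn2r ?nnegrE// ltW//; exact: Ae.
have [A FA A1] := Fc' 1 ltr01; have [y Ay] := filter_ex FA.
have yz : (y : nat -> R) - z \in sqsum.
  by apply/sqsumP; exists 1 => n; rewrite -[leRHS](expr1n _ 2); exact: (key _ A).
have zs : z \in sqsum.
  by rewrite -(subKr (y : nat -> R) z) rpredB//; exact: valP.
apply/cvg_ex; exists (L2 zs); apply/cvgrPdist_le => e e0.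
have [B FB Be] := Fc' e e0.
move: (FB); apply: filterS => x Bx; rewrite distrC.
rewrite -(@ler_pXn2r _ 2)// ?nnegrE ?(ltW e0)// l2norm_sqr.
by apply: l2dot_le => n; exact: (key _ B).
Qed.

HB.instance Definition _ := Uniform_isComplete.Build l2 l2_complete.

End SquareSummable.

(** * Sufficiency *)

Section LimInf.
Variable R : realType.
Implicit Types (u : (\bar R)^nat).
Local Open Scope ereal_scope.

Lemma limn_einf_sup_einfs u : limn_einf u = ereal_sup (range (einfs u)).
Proof. by rewrite limn_einf_lim; apply/cvg_lim => //; exact: cvg_einfs_sup. Qed.

Lemma limn_einf_lt u c : limn_einf u < c -> exists n, u n < c.
Proof.
apply: contraPP => /forallNP h; apply/negP; rewrite -leNgt.
rewrite limn_einf_sup_einfs.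
apply: le_trans (ereal_sup_ubound _); last by exists 0%N.
by apply: le_ereal_inf_tmp => _ [n _ <-]; rewrite leNgt; exact/negP/h.
Qed.

Lemma limn_einf_ge0 u : (forall n, 0 <= u n) -> 0 <= limn_einf u.
Proof.
move=> u0; rewrite leNgt; apply/negP => /limn_einf_lt[n].
by rewrite ltNge u0.
Qed.

Lemma limn_einf_gt0 u : 0 < limn_einf u ->
  exists c : R, exists N, (0 < c)%R /\ forall n, (N <= n)%N -> c%:E <= u n.
Proof.
rewrite limn_einf_sup_einfs => /ereal_sup_gt[_ [N _ <-]] h.
have [c c0 cu] : exists2 c : R, (0 < c)%R & c%:E <= einfs u N.
  case: (einfs u N) h => [r||]// r0; first by exists r.
  by exists 1%R => //; rewrite leey.
exists c, N; split=> // n Nn; apply: le_trans cu _.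
by apply: ereal_inf_lbound; exists n.
Qed.

End LimInf.

(** * Energy estimates for the greedy algorithm *)

Section Sufficiency.
Variables (R : realType) (H : completeNormedModType R) (ip : {dot H for idfun}).
Hypothesis ipN : induces_norm ip.
Implicit Types x y z : H.

Lemma norm_dot_sqr x : `|x| ^+ 2 = ip x x.
Proof. by rewrite ipN sqr_sqrtr// dot_ge0. Qed.

Lemma ler_norm_dot x y : `|ip x y| <= `|x| * `|y|.
Proof.
rewrite -(@ler_pXn2r _ 2)// ?nnegrE ?mulr_ge0// exprMn !norm_dot_sqr.
by rewrite real_normK ?num_real// dot_cauchy_schwarz.
Qed.

(** The half-space of all z with [ip y z <= s] is convex and contains [D] and its opposite, hence
    the hull; by Cauchy-Schwarz the bound survives the closure. *)
Lemma A1_dot_le (D : set H) x y s :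
  (forall d, D d -> `|ip y d| <= s) -> A1 D x -> ip y x <= s.
Proof.
move=> Ds Dx.
have hull : convex_hull [set z | D z \/ D (- z)] `<=` [set z | ip y z <= s].
  apply: smallest_sub => [|z [/Ds|/Ds]]/=; last 2 first.
  - by rewrite ler_norml => /andP[].
  - by rewrite [ip y (- z)]raddfN normrN ler_norml => /andP[].
  move=> u v l; rewrite !inE/= => us vs.
  have l0 : 0 <= l%:num by []; have l1 : l%:num <= 1 by [].
  rewrite [ip y _](_ : _ = ip y (l%:num *: u + (1 - l%:num) *: v))//.
  by rewrite dotDr !dotZr; nra.
apply/ler_addgt0Pr => e e0.
(* The added 1 covers the case y = 0. *)
have d0 : 0 < e / (`|y| + 1) by rewrite divr_gt0// ltr_wpDl.
have [z [/hull zs /=]] := Dx _ (nbhsx_ballx x _ d0).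
rewrite -ball_normE/= => xz.
rewrite -(subrK z x) addrC dotDr lerD//.
apply: le_trans (ler_norm _) _; apply: le_trans (ler_norm_dot _ _) _.
apply: (@le_trans _ _ ((`|y| + 1) * (e / (`|y| + 1)))); last first.
  by rewrite mulrC divfK// gt_eqF// ltr_wpDl.
by rewrite ler_pM// ?lerDl// ltW.
Qed.

Variables (D : set H) (t : nat -> R) (x : H) (f phi : nat -> H).
Hypothesis D1 : forall g, D g -> `|g| = 1.
Hypothesis fphi : WGA_realization ip D t x f phi.

Let c m := ip (f m) (phi m).
Let s m := sup [set `|ip (f m) g| | g in D].

Lemma WGA_energy m : ip (f m.+1) (f m.+1) = ip (f m) (f m) - c m ^+ 2.
Proof.
have [_ /(_ m)[/D1 p1 _ ->]] := fphi.
rewrite !(dotBl, dotBr, dotZl, dotZr) (dotC ip (phi m) (f m)) -(norm_dot_sqr (phi m)).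
by rewrite p1 -/(c m); ring.
Qed.

Lemma WGA_energy_sum m :
  ip (f m) (f m) + \sum_(j < m) c j ^+ 2 = ip x x.
Proof.
elim: m => [|m IH]; first by rewrite big_ord0 addr0 (fphi.1).
by rewrite WGA_energy big_ord_recr/= -IH; ring.
Qed.

Lemma WGA_sum m : x = f m + \sum_(j < m) c j *: phi j.
Proof.
elim: m => [|m IH]; first by rewrite big_ord0 addr0 (fphi.1).
have [_ /(_ m)[_ _ ->]] := fphi; rewrite big_ord_recr/= [LHS]IH.
by rewrite -/(c m) [RHS]addrCA subrK addrC.
Qed.

Lemma WGA_dot_le_sup m d : D d -> `|ip (f m) d| <= s m.
Proof.
move=> Dd; apply: ub_le_sup; last by exists d.
exists `|f m| => _ [g Dg <-].
by apply: le_trans (ler_norm_dot _ _) _; rewrite (D1 Dg) mulr1.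
Qed.

Lemma WGA_energy_le m : A1 D x ->
  ip (f m) (f m) <= s m * (1 + \sum_(j < m) `|c j|).
Proof.
move=> Dx.
have -> : ip (f m) (f m) = ip (f m) x - \sum_(j < m) c j * ip (f m) (phi j).
  rewrite [in ip _ x](WGA_sum m) dotDr raddf_sum/=.
  by under [X in _ + X - _]eq_bigr do rewrite dotZr; rewrite addrK.
rewrite mulrDr mulr1; apply: lerD.
  by apply: A1_dot_le Dx => d; exact: WGA_dot_le_sup.
rewrite mulr_sumr -sumrN; apply: ler_sum => j _.
apply: le_trans (ler_norm _) _; rewrite normrN normrM mulrC ler_wpM2r//.
by apply: WGA_dot_le_sup; have [_ /(_ j)[]] := fphi.
Qed.

Lemma WGA_energy_nonincreasing m n : (m <= n)%N ->
  ip (f n) (f n) <= ip (f m) (f m).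
Proof.
elim: n => [|n IH]; first by rewrite leqn0 => /eqP ->.
rewrite leq_eqVlt => /predU1P[->//|/IH]; apply: le_trans.
by rewrite WGA_energy gerBl sqr_ge0.
Qed.

Lemma WGA_cvg : weakness_sequence t -> liminf_condition t -> A1 D x ->
  (fun m => `|f m|) @ \oo --> (0 : R).
Proof.
move=> tw tc Dx.
(* The geometric term keeps [a] square-summable. It makes every [a j] positive, so the quotient is
   +oo where [t] vanishes, and its first value 1 makes all the sums [S n] at least 1. *)
pose a j : R := `|c j| + 2^-1 ^+ j.
have a0 j : 0 < a j by rewrite ltr_wpDl// exprn_gt0.
pose S n : R := \sum_(j < n.+1) a j.
have S1 n : 1 <= S n.
  rewrite /S big_ord_recl/= ler_wpDr//; last by rewrite /a expr0 lerDr.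
  by apply: sumr_ge0 => j _; exact: ltW.
have Sc n : \sum_(j < n) `|c j| <= S n.
  rewrite /S big_ord_recr/= ler_wpDr ?(ltW (a0 n))//.
  by apply: ler_sum => j _; rewrite lerDl exprn_ge0.
have geo n : \sum_(j < n) (2^-1 ^+ j) ^+ 2 <= 2 :> R.
  (* The bound is strengthened so that the induction goes through. *)
  suff : \sum_(j < n) (2^-1 ^+ j) ^+ 2 <= 2 - 2 * (2^-1 ^+ n) ^+ 2 :> R.
    by move=> /le_trans; apply; rewrite gerBl mulr_ge0 ?sqr_ge0.
  elim: n => [|n IH]; first by rewrite big_ord0 expr0; lra.
  by rewrite big_ord_recr/= (exprS 2^-1 n); have := sqr_ge0 (2^-1 ^+ n : R); nra.
have /tc : forall j, 0 <= a j by move=> j; exact: ltW.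
have /[swap]/[apply] : cvgn (series (fun j => a j ^+ 2)).
  have [] // := @nneg_series_le _ (fun j => a j ^+ 2) (2 * ip x x + 2 * 2).
    by move=> i; exact: sqr_ge0.
  move=> n; apply: (@le_trans _ _ (\sum_(j < n)
      (2 * c j ^+ 2 + 2 * (2^-1 ^+ j) ^+ 2))).
    apply: ler_sum => j _; rewrite /a -[c j ^+ 2]real_normK ?num_real//.
    by have := sqr_ge0 (`|c j| - 2^-1 ^+ j); nra.
  rewrite big_split/= -!mulr_sumr.
  apply: lerD; apply: ler_wpM2l => //; last exact: geo.
  by rewrite -(WGA_energy_sum n) lerDr dot_ge0.
set u := (fun n => _); move=> lim0.
(* The factor 2 comes from bounding both 1 and the sum of the |c_j|, j < m, by [S m]. *)
have eu m : ((ip (f m) (f m))%:E <= 2%:E * u m)%E.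
  have /andP[t0 _] := tw m.
  rewrite /u; have [->|tm] := eqVneq (t m) 0.
    rewrite inve0 gt0_muley ?lte_fin// gt0_mulye ?lte_fin ?(lt_le_trans ltr01 (S1 m))//.
    by rewrite gt0_muley ?lte_fin// leey.
  rewrite inver (negPf tm) -!EFinM lee_fin.
  apply: le_trans (WGA_energy_le m Dx) _.
  have st : s m <= a m / t m.
    rewrite ler_pdivlMr ?lt_def ?tm// mulrC.
    have [_ /(_ m)[_ h _]] := fphi; apply: le_trans h _.
    by rewrite lerDl exprn_ge0.
  have s0 : 0 <= s m.
    by have [_ /(_ m)[/(WGA_dot_le_sup m) h _ _]] := fphi; apply: le_trans h.
  rewrite mulrCA; apply: ler_pM => //.
    by rewrite addr_ge0// sumr_ge0.
  by have := S1 m; have := Sc m; rewrite -/(S m); lra.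
apply/cvgrPdist_lt => e e0.
(* A single index with a small term suffices, since the energy is nonincreasing. *)
have : (limn_einf u < (e ^+ 2 / 2)%:E)%E by rewrite lim0 lte_fin divr_gt0 ?exprn_gt0.
move=> /limn_einf_lt[m um].
have fm : ip (f m) (f m) < e ^+ 2.
  rewrite -lte_fin (le_lt_trans (eu m))//.
  rewrite [X in (_ < X)%E](_ : _ = 2%:E * (e ^+ 2 / 2)%:E)%E; last first.
    by rewrite -EFinM mulrC divfK// pnatr_eq0.
  by rewrite lte_pmul2l.
exists m => // n /= mn; rewrite sub0r normrN normr_id.
rewrite -(@ltr_pXn2r _ 2)// ?nnegrE ?(ltW e0)// norm_dot_sqr.
exact: le_lt_trans (WGA_energy_nonincreasing mn) fm.
Qed.

End Sufficiency.

(** * Spreading out a nonnegative sequence *)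

Section Run.
Variable R : realType.
Implicit Types (x F G : nat -> R) (a y b M : R).

Lemma exists_argmax x k :
  exists2 i, (i <= k)%N & forall j, (j <= k)%N -> x j <= x i.
Proof.
elim: k => [|k [i ik xi]]; first by exists 0%N => // j; rewrite leqn0 => /eqP ->.
have [xik|xik] := leP (x k.+1) (x i).
  by exists i; [exact: leqW|move=> j; rewrite leq_eqVlt => /predU1P[->//|/xi]].
exists k.+1 => // j; rewrite leq_eqVlt => /predU1P[->//|/xi ji].
exact: le_trans ji (ltW xik).
Qed.

Lemma sum_ord_widen F P Q : (Q <= P)%N -> (forall i, (Q <= i)%N -> F i = 0) ->
  \sum_(i < P) F i = \sum_(i < Q) F i.
Proof.
move=> QP F0; rewrite -(subnKC QP) big_split_ord/= addrC big1 ?add0r// => i _.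
by rewrite F0 ?leq_addr.
Qed.

Lemma sum_ord_update2 F G P i j : (i < P)%N -> (j < P)%N -> i != j ->
  (forall l, l != i -> l != j -> F l = G l) ->
  \sum_(l < P) F l = \sum_(l < P) G l + (F i - G i) + (F j - G j).
Proof.
move=> iP jP ij FG; pose i' := Ordinal iP; pose j' := Ordinal jP.
have ji : j' != i' by rewrite eq_sym.
rewrite (bigD1 i')//= (bigD1 j')//= [in RHS](bigD1 i')//= [in RHS](bigD1 j')//=.
rewrite (eq_bigr (fun l : 'I_P => G l)); first by ring.
by move=> l /andP[li lj]; rewrite FG.
Qed.

(** * Deletions and transfers of entries *)

Record state := State { entry : nat -> R; last_index : nat; top : R }.
(** Encodes the vector alpha e_src - beta e_dst; [gain] is its inner product with the current
    vector, hence the coefficient of the greedy step. *)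
Record move := Move { src : nat; dst : nat; alpha : R; beta : R }.

Definition mass s := \sum_(i < (last_index s).+1) entry s i.
Definition energy s := \sum_(i < (last_index s).+1) entry s i ^+ 2.
Definition gain s m := alpha m * entry s (src m) - beta m * entry s (dst m).

(* Only the entry of index [last_index s] may lie strictly between [0] and
   [top s / 4]: it is the one being filled. *)
Definition balanced s : Prop :=
  [/\ forall i, 0 <= entry s i <= top s,
      exists2 i, (i <= last_index s)%N & entry s i = top s,
      forall i, (last_index s < i)%N -> entry s i = 0 &
      forall i, (i < last_index s)%N -> entry s i = 0 \/ top s <= 4 * entry s i].

Definition unit_move m : Prop :=
  [/\ src m != dst m, 0 <= alpha m, 0 <= beta m & alpha m ^+ 2 + beta m ^+ 2 = 1].

(** The new entries are those of the greedy residual. The two alternatives are the deletion of a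
    greatest entry and a transfer with coefficient exactly [a]; the changes of mass and energy are
    recorded to control their ratio. *)
Definition step a s m s' : Prop :=
  [/\ unit_move m,
      forall i, entry s' i =
        entry s i - gain s m * (alpha m * (i == src m)%:R - beta m * (i == dst m)%:R),
      top s' <= top s, energy s' = energy s - gain s m ^+ 2 &
      [/\ top s < 4 * a, gain s m = top s & mass s' = mass s - top s] \/
      [/\ 4 * a <= top s, gain s m = a & mass s + a / 4 <= mass s']].

(** Supplies the transfer from a greatest entry M to a small entry y. The sum of the entries grows
    by b (be - al), at least b / 4, and the donor keeps at least 7 M / 8. *)
Lemma rotation M y b : 0 < M -> 0 <= y <= M / 4 -> 0 <= b <= M / 4 ->
  exists al be : R, [/\ 0 <= al, al + 1/4 <= be, al ^+ 2 + be ^+ 2 = 1,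
    al * M - be * y = b & al <= 1 / 2].
Proof.
move=> M0 /andP[y0 yM] /andP[b0 bM].
(* [(al, - be)] is a unit vector with inner product [b] with [(M, - y)]. *)
pose rho := M ^+ 2 + y ^+ 2; pose w := Num.sqrt (rho - b ^+ 2).
have rho0 : 0 < rho by rewrite ltr_pwDl ?exprn_gt0 ?sqr_ge0.
have w2 : w ^+ 2 = rho - b ^+ 2 by rewrite sqr_sqrtr// /rho; nra.
have w0 : 0 <= w := sqrtr_ge0 _.
pose al := (b * M + y * w) / rho; pose be := (M * w - b * y) / rho.
have rn : rho != 0 by rewrite gt_eqF.
have gE : al * M - be * y = b by rewrite /al /be /rho; field.
have uE : al ^+ 2 + be ^+ 2 = 1.
  have -> : al ^+ 2 + be ^+ 2 = (b ^+ 2 + w ^+ 2) * (M ^+ 2 + y ^+ 2) / rho ^+ 2.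
    by rewrite /al /be; field.
  by rewrite w2 -/rho; field.
have al0 : 0 <= al by rewrite divr_ge0 ?addr_ge0 ?mulr_ge0// ltW.
have be0 : 0 <= be.
  rewrite divr_ge0 ?(ltW rho0)// subr_ge0.
  have : b <= w by rewrite -(@ler_pXn2r _ 2)// ?nnegrE// w2 /rho; nra.
  by nra.
have be1 : be <= 1 by nra.
(* Here [al * M = b + be * y] is at most M/4 + M/4. Then [be ^+ 2] is at least 3/4, so [be] exceeds
   3/4. *)
have al2 : al <= 1 / 2 by nra.
by exists al, be; split => //; nra.
Qed.

(** Finds the entry k that receives the next transfer: the last one while it is still small,
    otherwise the fresh one after it. *)
Lemma balanced_fill s : balanced s -> 0 < top s -> exists k,
  [/\ (last_index s <= k)%N, entry s k <= top s / 4,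
      forall i, (k < i)%N -> entry s i = 0 &
      forall i, (i < k)%N -> entry s i = 0 \/ top s <= 4 * entry s i].
Proof.
move=> [x0 _ xk xl] M0; have [h|h] := leP (entry s (last_index s)) (top s / 4).
  by exists (last_index s); split.
exists (last_index s).+1; split => //.
- by rewrite xk// divr_ge0// ltW.
- by move=> i /ltnW; exact: xk.
- move=> i; rewrite ltnS leq_eqVlt => /predU1P[->|/xl//].
  by right; lra.
Qed.

Lemma step_exists a s : 0 <= a -> balanced s -> 0 < top s ->
  exists p : move * state, step a s p.1 p.2 /\ balanced p.2.
Proof.
move=> a0 bs M0; have [x0 [i0 ik xi0] xk xl] := bs.
set M := top s in x0 xi0 xl M0 *.
have [aM|Ma] := ltP M (4 * a).
  set k := last_index s in ik xk xl *.
  pose x' i := if i == i0 then 0 else entry s i.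
  have [i1 ik1 xi1] := exists_argmax x' k.
  have x'0 i : 0 <= x' i <= M.
    by rewrite /x'; case: ifP => // _; rewrite lexx ltW.
  have x'k i : (k < i)%N -> x' i = 0 by move=> /xk; rewrite /x'; case: ifP.
  have x'm i : x' i <= x' i1.
    have [/xi1//|/x'k ->] := leqP i k.
    by have /andP[] := x'0 i1.
  pose s' := State x' k (x' i1).
  (* As [beta] is 0, the target only has to differ from the source. *)
  pose m := Move i0 k.+1 1 0.
  have gE : gain s m = M by rewrite /gain/= mul1r mul0r subr0.
  have sumE (g : R -> R) : g 0 = 0 ->
      \sum_(i < k.+1) g (x' i) = \sum_(i < k.+1) g (entry s i) - g M.
    move=> g0; pose i0' := Ordinal (ik : (i0 < k.+1)%N).
    rewrite (bigD1 i0')//= [in RHS](bigD1 i0')//= /x' eqxx g0 xi0.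
    rewrite (eq_bigr (fun i : 'I_k.+1 => g (entry s i))); first by ring.
    by move=> i /negbTE; rewrite -val_eqE/= => ->.
  exists (m, s'); split; [split=> //=|split => /=].
  - by split=> //=; [rewrite neq_ltn ltnS ik|rewrite expr1n expr0n addr0].
  - move=> i; rewrite gE mul1r mul0r subr0 /x'.
    by case: eqP => [->|]; rewrite ?mulr1 ?mulr0 ?subr0// xi0 subrr.
  - by have /andP[] := x'0 i1.
  - by rewrite /energy/= gE (sumE (fun z => z ^+ 2))// expr0n.
  - by left; split=> //; rewrite /mass/= (sumE id).
  - by move=> i; rewrite x'm andbT; have /andP[] := x'0 i.
  - by exists i1.
  - exact: x'k.
  - move=> i /xl h; have [->|ii0] := eqVneq i i0; first by left; rewrite /x' eqxx.
    rewrite (_ : x' i = entry s i); last by rewrite /x' (negPf ii0).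
    have [->|{}h] := h; first by left.
    by right; apply: le_trans h; have /andP[] := x'0 i1.
(* Otherwise a transfer of coefficient [a] is made from the greatest entry [i0] to the small entry
   [k]. *)
have [k [kk yM xk' xl']] := balanced_fill bs M0.
rewrite -/M in yM xl'.
have y0 : 0 <= entry s k by have /andP[] := x0 k.
have [al [be [al0 abe uE gE al2]]] : exists al be : R,
    [/\ 0 <= al, al + 1/4 <= be, al ^+ 2 + be ^+ 2 = 1,
    al * M - be * entry s k = a & al <= 1 / 2].
  by apply: rotation => //; [exact/andP|lra].
have be0 : 0 <= be by lra.
have be1 : be <= 1 by nra.
have ki0 : i0 != k by apply: contraTneq yM => <-; rewrite xi0 -ltNge; lra.
have i0k : (i0 < k)%N by rewrite ltn_neqAle ki0 (leq_trans ik).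
pose x' i := entry s i - a * (al * (i == i0)%:R - be * (i == k)%:R).
have x'i0 : x' i0 = M - a * al.
  by rewrite /x' eqxx (negPf ki0) mulr1 mulr0 subr0 xi0.
have x'k : x' k = entry s k + a * be.
  by rewrite /x' eqxx eq_sym (negPf ki0) mulr1 mulr0 sub0r mulrN opprK.
have x'E i : i != i0 -> i != k -> x' i = entry s i.
  by move=> /negPf ii0 /negPf ik'; rewrite /x' ii0 ik' !mulr0 subrr mulr0 subr0.
(* The donor loses at most M/8 and the receiver ends at M/2 at most. *)
have x'0 i : 0 <= x' i <= M.
  have [->|ii0] := eqVneq i i0; first by rewrite x'i0; nra.
  have [->|ik'] := eqVneq i k; first by rewrite x'k; nra.
  by rewrite x'E.
have [i1 ik1 xi1] := exists_argmax x' k.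
have x'z i : (k < i)%N -> x' i = 0.
  move=> ki; rewrite x'E ?xk'//; first by rewrite gtn_eqF// (ltn_trans i0k).
  by rewrite gtn_eqF.
have x'm i : x' i <= x' i1.
  have [/xi1//|/x'z ->] := leqP i k.
  by have /andP[] := x'0 i1.
have i1M : x' i1 <= M by have /andP[] := x'0 i1.
pose m := Move i0 k al be.
have gainE : gain s m = a by rewrite /gain/= xi0.
have sumE (g : R -> R) : g 0 = 0 ->
    \sum_(i < k.+1) g (x' i) = \sum_(i < (last_index s).+1) g (entry s i)
      + (g (x' i0) - g M) + (g (x' k) - g (entry s k)).
  move=> g0; rewrite (@sum_ord_update2 (fun i => g (x' i))
    (fun i => g (entry s i)) _ i0 k)//; first last.
  - by move=> l l1 l2; rewrite x'E.
  - exact: ltnW.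
  rewrite xi0; congr (_ + _ + _).
  rewrite (@sum_ord_widen (fun i => g (entry s i)) k.+1 (last_index s).+1)// => i li.
  by rewrite xk.
exists (m, State x' k (x' i1)); split; [split=> //=|split => //=].
- by move=> i; rewrite gainE.
- rewrite /energy/= gainE (sumE (fun z => z ^+ 2)) ?expr0n//.
  rewrite x'i0 x'k -addrA; congr (_ + _).
  transitivity (a ^+ 2 * (al ^+ 2 + be ^+ 2) - 2 * a * (al * M - be * entry s k)).
    by ring.
  by rewrite uE gE; ring.
- right; split=> //; rewrite /mass/= (sumE id)// x'i0 x'k; nra.
- by move=> i; rewrite x'm andbT; have /andP[] := x'0 i.
- by exists i1.
- move=> i ik'; have [->|ii0] := eqVneq i i0; first by right; rewrite x'i0; nra.
  have x'i := x'E i ii0 (negbT (ltn_eqF ik')).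
  have [h|h] := xl' _ ik'; first by left; rewrite x'i.
  by right; rewrite x'i; exact: le_trans h.
Qed.

Lemma balanced_top_ge0 s : balanced s -> 0 <= top s.
Proof. by case=> /(_ 0%N)/andP[x0 xM] _ _ _; exact: le_trans xM. Qed.

Lemma balanced_top_sqr_le s : balanced s -> top s ^+ 2 <= energy s.
Proof.
case=> _ [i ik <-] _ _; pose i' := Ordinal (ik : (i < (last_index s).+1)%N).
rewrite /energy (bigD1 i')//= lerDl.
by apply: sumr_ge0 => j _; exact: sqr_ge0.
Qed.

Lemma energy_le_mass s : balanced s -> energy s <= mass s * top s.
Proof.
case=> x0 _ _ _; rewrite /mass mulr_suml; apply: ler_sum => i _.
by have := x0 i; nra.
Qed.

(** Below the last index, [top s] times an entry is at most 4 times its square. The last entry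
    contributes at most [top s ^+ 2], itself at most the energy; hence 4 + 1. *)
Lemma mass_le_energy s : balanced s -> mass s * top s <= 5 * energy s.
Proof.
move=> bs; have := balanced_top_sqr_le bs; have M0 := balanced_top_ge0 bs.
case: bs => x0 _ _ xl; rewrite /mass /energy !big_ord_recr/= mulrDl => h.
have : (\sum_(i < last_index s) entry s i) * top s <=
    4 * \sum_(i < last_index s) entry s i ^+ 2.
  rewrite mulr_suml mulr_sumr; apply: ler_sum => i _.
  have [->|xi] := xl i (ltn_ord i); first by rewrite mul0r expr0n mulr0.
  by have := x0 i; nra.
have := x0 (last_index s).
by nra.
Qed.

Lemma balanced_top_gt0 s : balanced s -> 0 < energy s -> 0 < top s.
Proof.
move=> bs e0; rewrite lt_def balanced_top_ge0// andbT.
by apply: contraTneq (energy_le_mass bs) => ->; rewrite mulr0 -ltNge.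
Qed.

(* A step with [gain s m = top s] removes [M] from the mass and [M ^ 2] from the
   energy; since [energy <= M * mass], this cannot decrease the ratio. *)
Lemma step_ratio a E s m s' : 0 < E -> balanced s -> 0 < energy s' ->
  energy s <= E -> 0 <= a -> step a s m s' ->
  mass s / energy s <= mass s' / energy s' /\
  (a / (4 * E) <= mass s' / energy s' - mass s / energy s \/ top s <= 4 * a).
Proof.
move=> E0 bs e'0 eE a0 [_ _ _ e'E tE].
have M0 := balanced_top_ge0 bs; have eM := energy_le_mass bs.
have e0 : 0 < energy s by have := sqr_ge0 (gain s m); lra.
have L0 : 0 <= mass s.
  by case: bs => x0 _ _ _; apply: sumr_ge0 => i _; have /andP[] := x0 i.
case: tE => [[aM gM tE]|[aM gM tE]]; rewrite gM in e'E.
  split; last by right; exact: ltW.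
  by rewrite ler_pdivlMr// mulrAC ler_pdivrMr// tE e'E; nra.
(* A transfer adds a / 4 to the mass and lowers the energy, which is at most [E]. *)
have h : mass s / energy s + a / (4 * E) <= mass s' / energy s'.
  apply: (@le_trans _ _ (mass s' / energy s)); last first.
    rewrite ler_pdivlMr// mulrAC ler_pdivrMr// ler_wpM2l//; last first.
      by rewrite e'E gerBl sqr_ge0.
    by apply: le_trans tE; rewrite addr_ge0// divr_ge0.
  rewrite ler_pdivlMr// mulrDl divfK ?gt_eqF//; apply: le_trans tE.
  rewrite lerD2l mulrAC ler_pdivrMr ?mulr_gt0//.
  by nra.
split; last by left; rewrite lerBrDl.
by apply: le_trans h; rewrite lerDl divr_ge0// mulr_ge0// ltW.
Qed.

(** The potential is r = mass / energy: it bounds the sum of the a_j from above, while top * r <= 5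
    for balanced states. With Q the sum of the a_j^2, this gives 20 (E + Q), below 25 E as Q <= E /
    64. *)
Lemma run_exists E lam K (a : nat -> R) : 0 < lam -> (0 < K)%N ->
  K%:R * lam ^+ 2 = E -> (forall j, 0 <= a j) ->
  (forall n, \sum_(j < n) a j ^+ 2 <= E / 64) ->
  exists (st : nat -> state) (mv : nat -> move),
  [/\ entry (st 0%N) = (fun i => if (i < K)%N then lam else 0),
      forall n, step (a n) (st n) (mv n) (st n.+1) &
      forall n, [/\ balanced (st n), top (st n) <= lam,
        E / 2 <= energy (st n) <= E & top (st n) * \sum_(j < n) a j <= 25 * E]].
Proof.
move=> lam0 K0 KE a0 aE.
have E0 : 0 < E by rewrite -KE mulr_gt0 ?ltr0n// exprn_gt0.
(* The last index is [K], one past the support: this null entry is the first to be filled. *)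
pose s0 := State (fun i => if (i < K)%N then lam else 0) K lam.
have [g gP] : {g : R * state -> move * state & forall p,
    0 <= p.1 -> balanced p.2 -> 0 < top p.2 ->
    step p.1 p.2 (g p).1 (g p).2 /\ balanced (g p).2}.
  apply: (@choice _ _ (fun (p : R * state) (q : move * state) =>
    0 <= p.1 -> balanced p.2 -> 0 < top p.2 ->
    step p.1 p.2 q.1 q.2 /\ balanced q.2)) => -[b s].
  have [[b0 [bs M0]]|h] := pselect (0 <= b /\ balanced s /\ 0 < top s).
    by have [q hq] := step_exists b0 bs M0; exists q.
  (* A dummy value where no step is required. *)
  by exists (Move 0 0 0 0, s) => /= b0 bs M0; case: h.
pose st := fix st n := if n is n'.+1 then (g (a n', st n')).2 else s0.
pose mv n := (g (a n, st n)).1.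
pose Q n := \sum_(j < n) a j ^+ 2.
have Q0 n : 0 <= Q n by apply: sumr_ge0 => j _; exact: sqr_ge0.
pose r n := mass (st n) / energy (st n).
have inv n : [/\ balanced (st n), top (st n) <= lam,
    E - 16 * Q n <= energy (st n) <= E & \sum_(j < n) a j <= 4 * r n * (E + Q n)] /\
    (0 < top (st n) /\ 0 < energy (st n)).
  suff h : [/\ balanced (st n), top (st n) <= lam,
      E - 16 * Q n <= energy (st n) <= E &
      \sum_(j < n) a j <= 4 * r n * (E + Q n)].
    split=> //; case: h => bs _ /andP[e1 _] _.
    have e0 : 0 < energy (st n) by have := aE n; rewrite -/(Q n); lra.
    by split=> //; exact: balanced_top_gt0.
  elim: n => [|n [bs tl /andP[e1 e2] ra]].
    have eE : energy s0 = E.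
      rewrite /energy/= big_ord_recr/= ltnn expr0n addr0.
      rewrite (eq_bigr (fun=> lam ^+ 2)) ?sumr_const ?card_ord ?mulr_natl//.
        by rewrite -mulr_natl.
      by move=> i _; rewrite ltn_ord.
    split=> //=.
    - split=> /=.
      + by move=> i; case: ifP; rewrite ?lexx ltW.
      + by exists 0%N => //; rewrite K0.
      + by move=> i Ki; rewrite ltnNge (ltnW Ki).
      + by move=> i ->; right; lra.
    - by rewrite eE /Q big_ord0 mulr0 subr0 !lexx.
    - rewrite big_ord0 mulr_ge0//; last by rewrite addr_ge0// ltW.
      rewrite mulr_ge0// divr_ge0//; last by rewrite [energy _]eE ltW.
      by apply: sumr_ge0 => i _ /=; case: ifP => // _; exact: ltW.
  have e0 : 0 < energy (st n) by have := aE n; rewrite -/(Q n); lra.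
  have M0 := balanced_top_gt0 bs e0.
  have [sP bs'] := gP (a n, st n) (a0 n) bs M0.
  rewrite /= -/(st n.+1) -/(mv n) in sP bs'.
  have QS : Q n.+1 = Q n + a n ^+ 2 by rewrite /Q big_ord_recr.
  have [_ _ tt eE gE] := sP.
  (* A deletion occurs only when the greatest entry is below [4 * a n]. *)
  have g16 : gain (st n) (mv n) ^+ 2 <= 16 * a n ^+ 2.
    have an := a0 n.
    by case: gE => [[h -> _]|[h -> _]]; nra.
  have e1' : E - 16 * Q n.+1 <= energy (st n.+1) by rewrite QS eE; lra.
  have e0' : 0 < energy (st n.+1) by have := aE n.+1; rewrite -/(Q n.+1); lra.
  have [rr rh] := step_ratio E0 bs e0' e2 (a0 n) sP.
  rewrite -/(r n) -/(r n.+1) in rr rh.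
  split=> //.
  - exact: le_trans tl.
  - by rewrite e1'/= eE; have := sqr_ge0 (gain (st n) (mv n)); lra.
  have r0 : 1 <= top (st n) * r n.
    rewrite /r mulrA ler_pdivlMr// mul1r mulrC.
    by have := energy_le_mass bs; rewrite mulrC.
  have rp : 0 <= r n by nra.
  rewrite big_ord_recr/= QS.
  have an := a0 n; have Qn := Q0 n.
  (* Either r grows by [a n / (4 * E)], or [top (st n) <= 4 * a n]; then 1 <= top * r gives
     [a n <= 4 * r n * a n ^+ 2], which is paid for by the growth of [Q]. *)
  have step1 : 4 * r n * (E + Q n) + a n <= 4 * r n.+1 * (E + (Q n + a n ^+ 2)).
    case: rh => [rh|rh].
      have : a n <= 4 * E * (r n.+1 - r n).
        by rewrite -ler_pdivrMl ?mulr_gt0// mulrC.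
      have : 0 <= (r n.+1 - r n) * Q n by rewrite mulr_ge0// subr_ge0.
      have : 0 <= r n.+1 * a n ^+ 2 by rewrite mulr_ge0 ?sqr_ge0// (le_trans rp).
      by nra.
    have h1 : a n <= 4 * r n * a n ^+ 2.
      have : a n * 1 <= a n * (4 * a n * r n).
        rewrite ler_wpM2l// (le_trans r0)// ler_wpM2r//.
      by rewrite mulr1 => /le_trans; apply; rewrite le_eqVlt; apply/orP; left;
        apply/eqP; ring.
    have : 0 <= (r n.+1 - r n) * (E + (Q n + a n ^+ 2)).
      by rewrite mulr_ge0 ?subr_ge0 ?addr_ge0 ?sqr_ge0// ltW.
    by nra.
  by apply: le_trans step1; rewrite lerD2r.
exists st, mv; split => // n.
  have [[bs _ _ _] [M0 _]] := inv n.
  by have [] := gP (a n, st n) (a0 n) bs M0.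
have [[bs tl /andP[e1 e2] ra] [M0 e0]] := inv n.
have Qn := aE n; rewrite -/(Q n) in Qn.
split=> //; first by rewrite e2 andbT; lra.
have rM : top (st n) * r n <= 5.
  by rewrite /r mulrA ler_pdivrMr// mulrC; exact: mass_le_energy.
have : top (st n) * \sum_(j < n) a j <= top (st n) * (4 * r n * (E + Q n)).
  by rewrite ler_wpM2l// ltW.
move=> /le_trans; apply.
rewrite [leLHS](_ : _ = 4 * (top (st n) * r n) * (E + Q n)); last by ring.
have EQ : 0 <= E + Q n by rewrite addr_ge0// ltW.
by nra.
Qed.

End Run.

(** * Necessity *)

(** The mean of n + 2 points combines that of the first n + 1, with weight (n + 1) / (n + 2), and
    the last point. *)
Lemma convex_mean (R : realType) (V : lmodType R) (C : set V) (g : nat -> V) n :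
  convex_set C -> (forall i, C (g i)) ->
  C (n.+1%:R^-1 *: \sum_(i < n.+1) g i).
Proof.
move=> Cc Cg; elim: n => [|n IH].
  by rewrite big_ord_recr big_ord0 /= add0r invr1 scale1r.
have p0 : 0 <= n.+1%:R / n.+2%:R :> R by rewrite divr_ge0.
have p1 : n.+1%:R / n.+2%:R <= 1 :> R.
  by rewrite ler_pdivrMr ?ltr0n// mul1r ler_nat.
have := Cc (n.+1%:R^-1 *: \sum_(i < n.+1) g i) (g n.+1) (Itv01 p0 p1).
rewrite !inE => /(_ IH (Cg _)).
rewrite [X in C X](_ : _ =
  (n.+1%:R / n.+2%:R) *: (n.+1%:R^-1 *: \sum_(i < n.+1) g i) +
  (1 - n.+1%:R / n.+2%:R) *: g n.+1)//.
rewrite [in X in _ -> X]big_ord_recr/= scalerDr scalerA.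
rewrite mulrAC divff ?pnatr_eq0// mul1r.
rewrite (_ : 1 - _ = n.+2%:R^-1)//; apply: (@mulIf _ n.+2%:R).
  by rewrite pnatr_eq0.
by rewrite mulrBl divfK ?mulVf ?pnatr_eq0// mul1r -natrB// subSnn.
Qed.

(** * A dictionary of vectors with two coordinates of opposite signs *)

Section PlaneDictionary.
Variable R : realType.

Lemma unit_coord_sqsum i : (fun j => (j == i)%:R : R) \in @sqsum R.
Proof.
apply/sqsumP; exists 1 => n; have [ni|ni] := ltnP i n.
  rewrite (bigD1 (Ordinal ni))//= eqxx expr1n big1 ?addr0// => j.
  by rewrite -val_eqE/= => /negPf ->; rewrite expr0n.
rewrite big1// => j _; rewrite (_ : _ == _ = false) ?expr0n//.
by apply/negbTE; rewrite neq_ltn (leq_trans (ltn_ord j) ni).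
Qed.

Definition l2e i : l2 R := L2 (unit_coord_sqsum i).

Lemma l2dot_e (f : l2 R) i : l2dot f (l2e i) = f i.
Proof.
apply/cvg_lim => //; apply: cvg_near_cst; exists i.+1 => // n /= ni.
rewrite seriesEord/= (bigD1 (Ordinal ni))//= eqxx mulr1 big1 ?addr0// => j.
by rewrite -val_eqE/= => /negPf ->; rewrite mulr0.
Qed.

Lemma l2_sumE n (F : 'I_n -> l2 R) j : (\sum_(i < n) F i) j = \sum_(i < n) F i j.
Proof.
rewrite -l2dot_e l2dotC [LHS](raddf_sum (l2ip R (l2e j))).
by apply: eq_bigr => i _; rewrite [LHS]l2dotC l2dot_e.
Qed.


Definition move_vec (m : move R) : l2 R :=
  alpha m *: l2e (src m) - beta m *: l2e (dst m).

Definition plane_dictionary : set (l2 R) :=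
  [set g | exists2 m, unit_move m & g = move_vec m].

Lemma l2dot_move (f : l2 R) m :
  l2dot f (move_vec m) = alpha m * f (src m) - beta m * f (dst m).
Proof.
transitivity (l2ip R f (move_vec m)) => //.
by rewrite dotBr !dotZr /= !l2dot_e.
Qed.

Lemma norm_move_vec m : unit_move m -> `|move_vec m| = 1.
Proof.
move=> [sd _ _ ab]; apply/eqP; rewrite -(@eqrXn2 _ 2)// expr1n l2norm_sqr.
rewrite l2dot_move (_ : (move_vec m) _ = alpha m); last first.
  transitivity (alpha m * (src m == src m)%:R - beta m * (src m == dst m)%:R) => //.
  by rewrite eqxx (negPf sd) mulr1 mulr0 subr0.
rewrite (_ : (move_vec m) _ = - beta m); last first.
  transitivity (alpha m * (dst m == src m)%:R - beta m * (dst m == dst m)%:R) => //.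
  by rewrite eqxx eq_sym (negPf sd) mulr1 mulr0 sub0r.
by rewrite mulrN opprK -!expr2 ab.
Qed.

Lemma plane_dictionary_e i : plane_dictionary (l2e i).
Proof.
exists (Move i i.+1 1 0); last by rewrite /move_vec/= scale1r scale0r subr0.
by split=> //=; [rewrite ltn_eqF|rewrite expr1n expr0n addr0].
Qed.

Lemma plane_dictionaryP : dictionary plane_dictionary.
Proof.
split=> [_ [m mu ->]|]; first exact: norm_move_vec.
rewrite -subTset => f _ B /nbhs_ballP[e /= e0 eB].
have cf := @l2_cvg_dot _ f f.
have /cvgrPdist_lt/(_ _ (exprn_gt0 2 e0))[n _ nP] := cf.
have {nP} fn : `|l2dot f f - \sum_(k < n) f k * f k| < e ^+ 2.
  by have := nP n (leqnn n); rewrite [series _ n]big_mkord.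
(* The truncation of [f], at squared distance |f|^2 minus the n-th partial sum. *)
pose g : l2 R := \sum_(i < n) f i *: l2e i.
have gE (i : 'I_n) : g i = f i.
  rewrite /g l2_sumE (bigD1 i)//= big1 ?addr0; last first.
    move=> j ji; transitivity (f j * (i == j :> nat)%:R) => //.
    by rewrite (_ : _ == _ = false) ?mulr0//; apply/negbTE; rewrite eq_sym.
  by transitivity (f i * (i == i :> nat)%:R) => //; rewrite eqxx mulr1.
have fgE (h : l2 R) : l2dot h g = \sum_(i < n) f i * h i.
  rewrite [LHS](raddf_sum (l2ip R h)).
  by apply: eq_bigr => i _; rewrite /= (dotZr (l2ip R)) /= l2dot_e.
exists g; split.
  by exists n, (fun i : 'I_n => f i), (fun i : 'I_n => l2e i); split=> // i;
    exact: plane_dictionary_e.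
apply: eB; rewrite -ball_normE/=.
rewrite -(@ltr_pXn2r _ 2)// ?nnegrE ?(ltW e0)// l2norm_sqr.
rewrite (_ : l2dot _ _ = l2dot f f - l2dot f g - (l2dot f g - l2dot g g)); last first.
  by rewrite [LHS](dotBl (l2ip R)) !(dotBr (l2ip R)) (dotC (l2ip R) g f).
rewrite !fgE.
under [X in _ - (_ - X)]eq_bigr do rewrite gE.
by rewrite subrr subr0; apply: le_lt_trans (ler_norm _) fn.
Qed.

(** The inner product is a difference of two numbers in [0, M]; with equal signs it could reach sqrt
    2 times M. *)
Lemma l2dot_plane_le (f : l2 R) M g : (forall i, 0 <= f i <= M) ->
  plane_dictionary g -> `|l2dot f g| <= M.
Proof.
move=> fM [m [_ a0 b0 ab] ->]; rewrite l2dot_move ler_norml.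
have := fM (src m); have := fM (dst m).
move: (f _) (f _) (alpha m) (beta m) a0 b0 ab => u v al be a0 b0 ab uM vM.
have al1 : al <= 1 by nra.
have be1 : be <= 1 by nra.
by apply/andP; split; nra.
Qed.

Lemma A1_plane_mean K : A1 plane_dictionary (K.+1%:R^-1 *: \sum_(i < K.+1) l2e i).
Proof.
apply: subset_closure => C [Cc CD].
by apply: convex_mean => // i; apply: CD; left; exact: plane_dictionary_e.
Qed.

Lemma l2_induces_norm : induces_norm (H := l2 R) (l2ip R).
Proof. by []. Qed.

Lemma plane_dictionary_not_converges (t a : nat -> R) (c : R) N :
  weakness_sequence t -> (forall j, 0 <= a j) ->
  cvgn (series (fun j => a j ^+ 2)) -> 0 < c ->
  (forall n, (N <= n)%N -> c * t n <= a n * \sum_(j < n.+1) a j) ->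
  ~ A1_converges (H := l2 R) (l2ip R) plane_dictionary t.
Proof.
move=> tw a0 ca c0 ct conv.
(* 27 = 25 + 1 + 1: the bound for the run, the omitted initial terms and the current term [a n]. *)
pose E := c / 27; have E0 : 0 < E by rewrite divr_gt0.
pose Q n := \sum_(j < n) a j ^+ 2.
have [N1 NN1 tail] : exists2 N1, (N <= N1)%N & forall n, Q n - Q N1 <= E / 128.
  have E128 : 0 < E / 128 by rewrite divr_gt0.
  have /cvgrPdist_lt/(_ _ E128)[m _ mP] := ca.
  exists (maxn m N); first exact: leq_maxr.
  move=> n; have := mP (maxn m N) (leq_maxl _ _).
  rewrite [series _ (maxn m N)]big_mkord => h.
  have := @nneg_sum_le_lim _ (fun j => a j ^+ 2) n (fun j => sqr_ge0 _) ca.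
  rewrite -/(Q n) => hn; move: h; rewrite -/(Q _) => /(le_lt_trans (ler_norm _)) h.
  by lra.
pose S1 := \sum_(j < N1) a j.
have S10 : 0 <= S1 by apply: sumr_ge0.
(* As lam^2 = E / (K + 1), the first summand yields [Nlam] and the second [Slam]. The bounds E / 128
   in [tail] and [Nlam] add up to the E / 64 allowed for a run. *)
have [K KP] : exists K : nat, 128 * N1%:R + S1 ^+ 2 / E <= K.+1%:R.
  pose z := 128 * N1%:R + S1 ^+ 2 / E.
  have z0 : 0 <= z by rewrite addr_ge0 ?divr_ge0 ?mulr_ge0 ?sqr_ge0// ltW.
  exists (Num.bound z); apply: le_trans (ltW (archi_boundP z0)) _.
  by rewrite ler_nat.
have K0 : 0 < K.+1%:R :> R by rewrite ltr0n.
pose lam := Num.sqrt (E / K.+1%:R).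
have lam2 : lam ^+ 2 = E / K.+1%:R by rewrite sqr_sqrtr// divr_ge0// ltW.
have lam0 : 0 < lam by rewrite sqrtr_gt0 divr_gt0.
have KE : K.+1%:R * lam ^+ 2 = E by rewrite lam2 mulrC divfK// gt_eqF.
have SE0 : 0 <= S1 ^+ 2 / E by rewrite divr_ge0 ?sqr_ge0// ltW.
have Nlam : N1%:R * lam ^+ 2 <= E / 128.
  have : 128 * N1%:R <= K.+1%:R :> R by lra.
  have := sqr_ge0 lam; nra.
have Slam : lam * S1 <= E.
  rewrite -(@ler_pXn2r _ 2)// ?nnegrE ?(ltW E0)// ?mulr_ge0 ?(ltW lam0)//.
  have : S1 ^+ 2 / E <= K.+1%:R by have : 0 <= N1%:R :> R by []; lra.
  rewrite ler_pdivrMr// exprMn lam2 => h.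
  by rewrite mulrAC ler_pdivrMr//; nra.
(* As [a' n = lam >= top (st n)] for [n < N1], the first [N1] steps only delete
   entries; their omitted terms [a n] are accounted for by [lam * S1 <= E]. *)
pose a' n := if (n < N1)%N then lam else a n.
have a'0 n : 0 <= a' n by rewrite /a'; case: ifP => // _; exact: ltW.
have sumE (g : R -> R) n : (N1 <= n)%N ->
    \sum_(j < n) g (a' j) =
    N1%:R * g lam + (\sum_(j < n) g (a j) - \sum_(j < N1) g (a j)).
  move=> /subnKC <-; rewrite !big_split_ord/= addrAC subrr add0r; congr (_ + _).
    rewrite (eq_bigr (fun=> g lam)) ?sumr_const ?card_ord ?mulr_natl// => i _.
    by rewrite /a' ltn_ord.
  by apply: eq_bigr => i _; rewrite /a' ltnNge leq_addr.
have Qa' n : \sum_(j < n) a' j ^+ 2 <= E / 64.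
  apply: (@le_trans _ _ (\sum_(j < maxn N1 n) a' j ^+ 2)).
    rewrite -(subnKC (leq_maxr N1 n)) big_split_ord/= lerDl.
    by apply: sumr_ge0 => j _; exact: sqr_ge0.
  rewrite (sumE (fun z => z ^+ 2)) ?leq_maxl//.
  by have := tail (maxn N1 n); rewrite /Q; lra.
have [st [mv [st0 stS stP]]] := run_exists lam0 (ltn0Sn K) KE a'0 Qa'.
(* This scaling turns the initial state into the mean of K + 1 basis vectors, an element of A_1. *)
pose th := (K.+1%:R * lam)^-1.
have th0 : 0 < th by rewrite invr_gt0 mulr_gt0.
pose x : l2 R := K.+1%:R^-1 *: \sum_(i < K.+1) l2e i.
pose phi n := move_vec (mv n).
pose f := fix f n := if n is n'.+1 then f n' - l2dot (f n') (phi n') *: phi n'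
                     else x.
have fE n i : f n i = th * entry (st n) i.
  elim: n i => [|n IH] i.
    rewrite st0 /= /x.
    transitivity (K.+1%:R^-1 * (\sum_(j < K.+1) (l2e j : l2 R)) i) => //.
    rewrite l2_sumE; case: ifPn => iK.
      rewrite (bigD1 (Ordinal iK))//= eqxx big1 ?addr0 ?mulr1; last first.
        move=> j; rewrite -val_eqE/= eq_sym => /negPf -> //.
      by rewrite /th invfM -mulrA mulVf ?mulr1// gt_eqF.
    rewrite mulr0 big1 ?mulr0// => j _ /=; rewrite (_ : _ == _ = false)//.
    by apply: contraNF iK => /eqP ->.
  have [_ -> _ _ _] := stS n.
  transitivity (f n i - l2dot (f n) (phi n) *
    (alpha (mv n) * (i == src (mv n))%:R - beta (mv n) * (i == dst (mv n))%:R)) => //.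
  by rewrite l2dot_move !IH /gain; ring.
have gE n : l2dot (f n) (phi n) = th * gain (st n) (mv n).
  by rewrite l2dot_move !fE /gain; ring.
have fM n i : 0 <= f n i <= th * top (st n).
  have [[/(_ i)/andP[x0 xM] _ _ _] _ _ _] := stP n.
  by rewrite fE mulr_ge0 ?(ltW th0)//= ler_wpM2l// ltW.
have real : WGA_realization (H := l2 R) (l2ip R) plane_dictionary t x f phi.
  split=> // n; have [um _ _ _ gn] := stS n.
  have [bs tl /andP[e1 e2] tS] := stP n.
  have M0 := balanced_top_ge0 bs; have ME := balanced_top_sqr_le bs.
  split=> //; first by exists (mv n).
  have /andP[t0 t1] := tw n.
  have g0 : 0 <= gain (st n) (mv n) by case: gn => [[_ -> _]|[_ -> _]].
  apply: (@le_trans _ _ (th * (t n * top (st n)))).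
    rewrite mulrCA ler_wpM2l//; apply: ge_sup.
      by exists `|l2dot (f n) (phi n)|, (phi n) => //; exists (mv n).
    by move=> _ [g Dg <-]; apply: l2dot_plane_le Dg.
  rewrite [l2ip R _ _]gE ger0_norm ?mulr_ge0 ?(ltW th0)// ler_wpM2l ?(ltW th0)//.
  (* A deletion is admissible because [t n <= 1]. A transfer cannot occur before [N1], where
     [a' n = lam] is at least the greatest entry. *)
  case: gn => [[_ -> _]|[an -> _]]; first by rewrite ler_piMl.
  have nN : (N1 <= n)%N.
    rewrite leqNgt; apply/negP => nN; move: an; rewrite /a' nN.
    by apply/negP; rewrite -ltNge; lra.
  have a'n : a' n = a n by rewrite /a' ltnNge nN.
  rewrite a'n in an; rewrite a'n.
  have ctn := ct n (leq_trans NN1 nN).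
  have : top (st n) * \sum_(j < n.+1) a j <= c.
    have := sumE id n nN; rewrite /= -/S1 => sE.
    rewrite big_ord_recr/= (_ : \sum_(i < n) a i =
      \sum_(j < n) a' j - N1%:R * lam + S1); last by rewrite sE; ring.
    have : top (st n) * S1 <= E by apply: le_trans Slam; rewrite ler_wpM2r.
    have : 0 <= top (st n) * (N1%:R * lam) by rewrite !mulr_ge0// ltW.
    have : top (st n) * a n <= E by nra.
    have -> : c = 27 * E by rewrite /E; field.
    by nra.
  (* Multiplying [ctn] by the greatest entry and using [Sc] gives c t_n top <= c a_n. *)
  move=> Sc; rewrite -(@ler_pM2l _ c)//.
  by have := a0 n; nra.
have Ax : A1 (H := l2 R) plane_dictionary x by exact: A1_plane_mean.
(* The energy of every state is at least E / 2, so no residual has a norm below this value. *)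
have d0 : 0 < th * Num.sqrt (E / 2) by rewrite mulr_gt0// sqrtr_gt0 divr_gt0.
have /cvgrPdist_lt/(_ _ d0)[n _ /(_ n (leqnn n))] := conv x Ax f phi real.
rewrite /= sub0r normrN normr_id => fn.
have [_ _ /andP[e1 _] _] := stP n.
have := l2dot_sum_le (f n) (last_index (st n)).+1.
under eq_bigr do rewrite fE exprMn; rewrite -mulr_sumr -/(energy (st n)) -l2norm_sqr.
apply/negP; rewrite -ltNge; apply: (@lt_le_trans _ _ ((th * Num.sqrt (E / 2)) ^+ 2)).
  by rewrite ltr_pXn2r ?nnegrE// ltW.
rewrite exprMn sqr_sqrtr; last by lra.
by rewrite ler_wpM2l ?sqr_ge0.
Qed.

End PlaneDictionary.

Lemma not_liminf_condition (R : realType) (t : nat -> R) :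
  weakness_sequence t -> ~ liminf_condition t ->
  exists a : nat -> R, exists c : R, exists N : nat,
  [/\ forall j, 0 <= a j, cvgn (series (fun j => a j ^+ 2)), 0 < c &
      forall n, (N <= n)%N -> c * t n <= a n * \sum_(j < n.+1) a j].
Proof.
move=> tw; rewrite /liminf_condition => /existsNP[a /not_implyP[a0]].
move=> /not_implyP[ca]; set u := (fun n => _) => lim0.
have S0 n : 0 <= \sum_(j < n) a j by apply: sumr_ge0.
have u0 n : (0 <= u n)%E.
  have /andP[t0 _] := tw n.
  by rewrite /u mule_ge0// ?lee_fin ?mule_ge0 ?lee_fin// inve_ge0 lee_fin.
(* The terms are nonnegative, so a nonzero lower limit is positive and bounds them below
   eventually. *)
have [|c [N [c0 cu]]] := @limn_einf_gt0 _ u.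
  by rewrite lt_def limn_einf_ge0// andbT; exact/eqP.
exists a, c, N; split=> // n /cu; have /andP[t0 _] := tw n.
have [->|tn] := eqVneq (t n) 0; first by rewrite mulr0 mulr_ge0.
rewrite /u inver (negPf tn) -!EFinM lee_fin mulrAC ler_pdivlMr//.
by rewrite lt_def tn.
Qed.

Theorem theorem6p3 (R : realType) (t : nat -> R) (ht : weakness_sequence t) :
  liminf_condition t <->
  (forall (H : completeNormedModType R) (ip : {dot H for idfun}) (D : set H),
     induces_norm ip -> dictionary D -> A1_converges ip D t).
Proof.
split=> [tc H ip D ipN [D1 _] x Dx f phi fphi|conv].
  exact: (WGA_cvg ipN D1 fphi).
apply: contrapT => /(not_liminf_condition ht)[a [c [N [a0 ca c0 ct]]]].
apply: (plane_dictionary_not_converges ht a0 ca c0 ct).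
by apply: conv; [exact: l2_induces_norm|exact: plane_dictionaryP].
Qed.
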